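(* Let $k$ be an algebraically closed field of characteristic $0$, let $t<n\le v$ be positive integers, let $(V,B)$ be a Steiner system of type $S(t,n,v)$ with $V=\{1,\dots,v\}$, and let $\mathcal H=\{H_1,\dots,H_v\}$ be a collection of $v$ distinct hyperplanes in $\mathbb P^n_k$ such that any $n$ of them meet in exactly one point and any $n+1$ of them have empty intersection. Let $I\subseteq k[x_0,\dots,x_n]$ be the ideal defining the Complement of the Steiner configuration of points associated to $(V,B)$ with respect to $\mathcal H$. Then Chudnovsky's Conjecture holds for $I$, that is, for all integers $h>1$, $$\frac{\alpha(I^{(h)})}{h}\ \ge\ \frac{\alpha(I)+n-1}{n}.$$
   Context: A Steiner system $(V,B)$ of type $S(t,n,v)$ is a set $V$ with $|V|=v$ together with a collection $B$ of $n$-element subsets of $V$ (blocks) such that each $t$-element subset of $V$ is contained in a unique block. Let $\ell_j\in k[x_0,\dots,x_n]$ be a linear form defining $H_j$. For an $n$-element subset $\sigma=\{\sigma_1,\dots,\sigma_n\}\subseteq V$, let $P_{\mathcal H,\sigma}=H_{\sigma_1}\cap\dots\cap H_{\sigma_n}$, a point of $\mathbb P^n_k$ with vanishing ideal $I_{P_{\mathcal H,\sigma}}=(\ell_{\sigma_1},\dots,\ell_{\sigma_n})$. Let $C_{(n,v)}$ be the set of all $n$-element subsets of $V$. The Complement of the Steiner configuration of points is $X_C=\bigcup_{\sigma\in C_{(n,v)}\setminus B}P_{\mathcal H,\sigma}$, with defining ideal $I=\bigcap_{\sigma\in C_{(n,v)}\setminus B}I_{P_{\mathcal H,\sigma}}$.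 For a radical ideal $I$, the $m$-th symbolic power is $I^{(m)}=\bigcap_{\mathfrak p\in \mathrm{Ass}(I)}\mathfrak p^m$. For a nonzero homogeneous ideal $J$, $\alpha(J)$ is the least degree $d$ such that $J_d\ne 0$.
   Formalization: The formal theorem assumes the Complement of the Steiner configuration is nonempty, which excludes exactly v = n; there B = {V}, I is the unit ideal, both alphas are 0, and the claimed inequality 0 ≥ (n-1)/n is false. *)

(* Defs.v *)
From mathcomp Require Import all_boot all_order all_algebra.
From mathcomp Require Import mpoly.
From Stdlib Require Import Classical ClassicalEpsilon.

Set Implicit Arguments.
Unset Strict Implicit.
Unset Printing Implicit Defensive.

Import Order.TTheory GRing.Theory Num.Theory.
Local Open Scope ring_scope.

Definition steiner_system (V : finType) (B : {set {set V}}) (t n v : nat) :=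
  [/\ #|V| = v,
      forall b : {set V}, b \in B -> #|b| = n
    & forall T : {set V}, #|T| = t -> exists! b : {set V}, b \in B /\ T \subset b].

(* Ideals are Prop-valued predicates: membership in the ideals below is not
   decidable by construction, so the boolean ideals of ring_quotient do not
   apply. *)
Section Ideals.
Variable R : comNzRingType.
Implicit Types (I J P S : R -> Prop) (f g : R).

Definition is_ideal J :=
  [/\ J 0, forall f g, J f -> J g -> J (f + g) & forall a f, J f -> J (a * f)].

Definition gen_ideal S : R -> Prop := fun f =>
  forall J, is_ideal J -> (forall g, S g -> J g) -> J f.

Definition mul_ideal I J : R -> Prop :=
  gen_ideal (fun f => exists g h, [/\ I g, J h & f = g * h]).

Fixpoint exp_ideal I (m : nat) : R -> Prop :=
  if m is m'.+1 then mul_ideal I (exp_ideal I m') else fun=> True.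

Definition prime_ideal P :=
  [/\ is_ideal P, ~ P 1 & forall f g, P (f * g) -> P f \/ P g].

(* P is the annihilator of the class of some f in R / I. *)
Definition associated_prime I P :=
  prime_ideal P /\ exists f, forall g, P g <-> I (g * f).

Definition symbolic_power I (m : nat) : R -> Prop := fun f =>
  forall P, associated_prime I P -> exp_ideal P m f.

End Ideals.

Section Alpha.
Variables (k : fieldType) (N : nat).
Implicit Types J : {mpoly k[N]} -> Prop.

Definition nonzero_in_degree J (d : nat) :=
  exists f : {mpoly k[N]}, [/\ J f, f \is d.-homog & f != 0].

Definition least_degree J (d : nat) :=
  nonzero_in_degree J d /\ forall e, nonzero_in_degree J e -> (d <= e)%N.

(* Meaningful only when J contains a nonzero form, see alphaP. *)
Definition alpha J : nat := epsilon (inhabits 0%N) (least_degree J).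

Lemma alphaP J :
  (exists d, nonzero_in_degree J d) -> least_degree J (alpha J).
Proof.
case=> d; have [m] := ubnP d; elim: m d => // m IHm d le_dm Jd.
have [[e [Je lt_ed]]|min_d] :=
  classic (exists e, nonzero_in_degree J e /\ (e < d)%N).
  by apply: (IHm e) => //; apply: leq_trans lt_ed _.
apply: epsilon_spec; exists d; split=> // e Je.
by rewrite leqNgt; apply/negP => lt_ed; apply: min_d; exists e.
Qed.

End Alpha.

Section Configuration.
Variables (k : fieldType) (n v : nat).

(* Points of P^n_k are the lines of k^(n+1), so that equality of points is
   Leibniz equality. *)
Definition proj_point := {W : {vspace 'rV[k]_n.+1} | \dim W == 1%N}.

Definition on_hyperplane (l : {mpoly k[n.+1]}) (p : proj_point) :=
  forall x : 'rV[k]_n.+1, x \in val p -> l.@[fun i => x 0 i] = 0.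

(* l j is a linear form defining the hyperplane H_j. *)
Variable l : 'I_v -> {mpoly k[n.+1]}.

Definition in_intersection (s : {set 'I_v}) (p : proj_point) :=
  forall j, j \in s -> on_hyperplane (l j) p.

Definition hyperplane_arrangement :=
  [/\ forall j, l j \is 1.-homog /\ l j != 0,
      forall i j, i <> j ->
        ~ (forall p, on_hyperplane (l i) p <-> on_hyperplane (l j) p),
      forall s : {set 'I_v}, #|s| = n -> exists! p, in_intersection s p
    & forall s : {set 'I_v}, #|s| = n.+1 -> ~ exists p, in_intersection s p].

Definition point_ideal (s : {set 'I_v}) : {mpoly k[n.+1]} -> Prop :=
  gen_ideal (fun f => exists2 j, j \in s & f = l j).

Definition complement_blocks (B : {set {set 'I_v}}) : {set {set 'I_v}} :=
  [set s : {set 'I_v} | #|s| == n] :\: B.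

Definition complement_configuration (B : {set {set 'I_v}}) (p : proj_point) :=
  exists2 s, s \in complement_blocks B & in_intersection s p.

Definition complement_ideal (B : {set {set 'I_v}}) : {mpoly k[n.+1]} -> Prop :=
  fun f => forall s, s \in complement_blocks B -> point_ideal s f.

End Configuration.

(* Main.v *)
(* Since any v - n + 1 hyperplanes include one of any n given ones, a product of
   v - n + 1 linear forms lies in I, so alpha(I) <= v - n + 1 and it suffices to
   prove alpha(I^(h)) >= h v / n.
   Distinct blocks share at most n - 2 elements, and v >= n + 2. Let F be a form
   of degree d < h v / n vanishing to order h on X_C. On each hyperplane H_i, the
   trace of X_C is the star configuration of v - 1 hyperplanes of P^(n-1) without
   the points of (n-1)-subsets which again pairwise share at most (n-1) - 2
   elements, and d < h (v - 1) / (n - 1); by induction on n, F vanishes on every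
   H_i. The induction ends on lines, where at most one point is missing. So F is
   divisible by the product of the v linear forms; the quotient has degree d - v
   and order at least h - n on X_C, and d - v < (h - n) v / n, so repeating this
   forces F = 0. *)
From HB Require Import structures.
Require Import Defs.
From mathcomp Require Import all_boot all_order all_algebra.
From mathcomp Require Import mpoly.
From mathcomp Require Import zify.
From Stdlib Require Import FunctionalExtensionality.

Set Implicit Arguments.
Unset Strict Implicit.
Unset Printing Implicit Defensive.

Import Order.TTheory GRing.Theory Num.Theory.
Local Open Scope ring_scope.

(** * Homogeneous polynomials, linear substitutions, order of vanishing *)

Lemma mpoly_rmorphism_ext (n : nat) (R : comNzRingType) (S : nzRingType)
    (f g : {rmorphism {mpoly R[n]} -> S}) :
  (forall c, f c%:MP = g c%:MP) -> (forall i, f 'X_i = g 'X_i) -> f =1 g.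
Proof.
move=> fgC fgX; elim/mpolyind=> [|c m p _ _ IHp]; first by rewrite !rmorph0.
rewrite !rmorphD IHp -mul_mpolyC !rmorphM fgC mpolyXE_id !rmorph_prod /=.
congr (_ * _ + _); apply: eq_bigr => i _.
by rewrite !rmorphXn /= fgX.
Qed.

Lemma dhomog_comp_mpoly (n m d : nat) (R : comNzRingType)
    (t : n.-tuple {mpoly R[m]}) (p : {mpoly R[n]}) :
  (forall i, tnth t i \is 1.-homog) -> p \is d.-homog ->
  p \mPo t \is d.-homog.
Proof.
move=> tP /dhomogP pP; rewrite comp_mpolyEX big_seq rpred_sum // => M /pP <-.
apply: dhomogZ; rewrite comp_mpolyX [X in X.-homog]mdegE.
elim/big_rec2: _ => [|i e q _ qP]; first exact: dhomog1.
by apply: dhomogM => //; rewrite -[X in X.-homog]mul1n dhomogMn.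
Qed.

Lemma pihomogM (n d e : nat) (R : comNzRingType) (p q : {mpoly R[n]}) :
  p \is e.-homog ->
  pihomog mdeg (e + d) (p * q) = p * pihomog mdeg d q.
Proof.
move=> pP; elim/mpolyind: q => [|c m q _ _ IHq].
  by rewrite mulr0 !raddf0 mulr0.
rewrite mulrDr !raddfD /= IHq mulrDr; congr (_ + _).
rewrite -scalerAr !linearZ /= pihomogX -scalerAr; congr (_ *: _).
have XP: 'X_[R, m] \is (mdeg m).-homog by rewrite dhomogX.
case: eqP => [<-|/eqP ne]; first exact/pihomog_dE/dhomogM.
rewrite mulr0; apply: (pihomog_ne0 (d := (e + mdeg m)%N)) (dhomogM pP XP).
by rewrite eqn_add2l.
Qed.

(** Each component of [p * q] is [p] times a component of [q], so in a domain only the component of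
    [q] of degree [d - e] survives. *)
Lemma homog_cofactor (n d e : nat) (R : idomainType) (p q : {mpoly R[n]}) :
  p * q \is d.-homog -> p * q != 0 -> p \is e.-homog ->
  (e <= d)%N /\ q \is (d - e).-homog.
Proof.
move=> pqP nz pP.
have pi_eq0 i : (e + i)%N != d -> pihomog mdeg i q = 0.
  move=> ne; apply/eqP; move: nz; rewrite mulf_eq0 negb_or => /andP[nzp _].
  suff: p * pihomog mdeg i q == 0 by rewrite mulf_eq0 (negPf nzp).
  by rewrite -(pihomogM i q pP) (pihomog_ne0 _ pqP) // eq_sym.
have defq := pihomog_partitionE (mf := mdeg) (leqnn (mmeasure mdeg q)).
have le_ed: (e <= d)%N.
  rewrite leqNgt; apply/negP=> lt_de; case/eqP: nz.
  by rewrite defq big1 ?mulr0 // => i _; apply: pi_eq0; lia.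
split=> //; rewrite defq rpred_sum // => i _.
have [eq_d|ne] := eqVneq (e + i)%N d; last by rewrite pi_eq0 // dhomog0.
by rewrite -eq_d addKn pihomogP.
Qed.

(** * Linear forms as column vectors, and linear substitutions *)

Section LinearForms.
Variable k : fieldType.

Definition linform N (a : 'cV[k]_N) : {mpoly k[N]} := \sum_i a i 0 *: 'X_i.

Lemma linform_homog N (a : 'cV[k]_N) : linform a \is 1.-homog.
Proof.
rewrite rpred_sum // => i _; rewrite dhomogZ // dhomogX.
by apply/eqP/mdeg1.
Qed.

Lemma linform_meval N (a : 'cV[k]_N) (x : 'rV_N) :
  (linform a).@[fun i => x 0 i] = (x *m a) 0 0.
Proof.
rewrite raddf_sum mxE; apply: eq_bigr => i _ /=.
by rewrite mevalZ mevalXU mulrC.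
Qed.

Lemma homog1_linform N (p : {mpoly k[N]}) :
  p \is 1.-homog -> exists a, p = linform a.
Proof.
move=> pP; exists (\col_i p@_U_(i)).
apply/mpolyP=> m; rewrite raddf_sum /=.
have [/mdeg1P[i /eqP ->]|ne1] := boolP (mdeg m == 1%N).
  rewrite (bigD1 i) //= big1 => [|j ne]; rewrite mcoeffZ mcoeffXU mxE.
    by rewrite eqxx mulr1 addr0.
  by rewrite (negPf ne) mulr0.
rewrite (dhomog_nemf_coeff pP ne1) big1 // => i _.
rewrite mcoeffZ mcoeffX; case: eqP => [eq_m|]; last by rewrite mulr0.
by case/mdeg1P: ne1; exists i; rewrite eq_m.
Qed.

Lemma linformD N : {morph @linform N : a b / a + b}.
Proof.
move=> a b; rewrite -big_split; apply: eq_bigr => i _ /=.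
by rewrite mxE scalerDl.
Qed.

Lemma linformZ N c : {morph @linform N : a / c *: a}.
Proof.
move=> a; rewrite scaler_sumr; apply: eq_bigr => i _ /=.
by rewrite mxE scalerA.
Qed.

Lemma linform0 N : @linform N 0 = 0.
Proof. by rewrite -(scale0r 0) linformZ scale0r. Qed.

Lemma linform_sum N I (r : seq I) (P : pred I) (F : I -> 'cV_N) :
  linform (\sum_(i <- r | P i) F i) = \sum_(i <- r | P i) linform (F i).
Proof. exact: (big_morph _ (@linformD N) (@linform0 N)). Qed.

Lemma linform_eq0 N (a : 'cV_N) : (linform a == 0) = (a == 0).
Proof.
apply/eqP/eqP=> [a0|->]; last exact: linform0.
apply/colP=> i; rewrite mxE; have := linform_meval a (delta_mx 0 i).
by rewrite a0 meval0 -rowE mxE.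
Qed.

Lemma linform_delta N i : linform (delta_mx i 0 : 'cV_N) = 'X_i.
Proof.
rewrite /linform (bigD1 i) //= big1 => [|j ne]; rewrite mxE.
  by rewrite !eqxx scale1r addr0.
by rewrite (negPf ne) scale0r.
Qed.

(* Precomposition with the linear map [x |-> x *m M] of row vectors. *)
Definition lsubst N N' (M : 'M[k]_(N', N)) (p : {mpoly k[N]}) : {mpoly k[N']} :=
  p \mPo [tuple linform (col i M) | i < N].

HB.instance Definition _ N N' (M : 'M_(N', N)) :=
  GRing.RMorphism.copy (lsubst M)
    (comp_mpoly [tuple linform (col i M) | i < N]).

Lemma lsubstX N N' (M : 'M_(N', N)) i : lsubst M 'X_i = linform (col i M).
Proof. by rewrite /lsubst comp_mpolyXU -tnth_nth tnth_mktuple. Qed.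

Lemma lsubstC N N' (M : 'M_(N', N)) c : lsubst M c%:MP = c%:MP.
Proof. exact: comp_mpolyC. Qed.

Lemma lsubst_homog N N' d (M : 'M_(N', N)) p :
  p \is d.-homog -> lsubst M p \is d.-homog.
Proof.
apply: dhomog_comp_mpoly => i; rewrite tnth_mktuple; exact: linform_homog.
Qed.

Lemma lsubst_linform N N' (M : 'M_(N', N)) a :
  lsubst M (linform a) = linform (M *m a).
Proof.
have ->: M *m a = \sum_i a i 0 *: col i M.
  apply/colP=> j; rewrite summxE mxE; apply: eq_bigr => i _.
  by rewrite !mxE mulrC.
rewrite linform_sum rmorph_sum; apply: eq_bigr => i _ /=.
by rewrite linformZ -!mul_mpolyC rmorphM /= lsubstC lsubstX.
Qed.

Lemma lsubst_comp N N' N'' (M : 'M_(N', N)) (M' : 'M_(N'', N')) p :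
  lsubst M' (lsubst M p) = lsubst (M' *m M) p.
Proof.
apply: (mpoly_rmorphism_ext (f := lsubst M' \o lsubst M)
  (g := lsubst (M' *m M))) => [c|i] /=; first by rewrite !lsubstC.
by rewrite !lsubstX lsubst_linform !colE mulmxA.
Qed.

End LinearForms.

(* [taylor x p] is [p (x + s X)] as a polynomial in [s]. It is locked because
   unification would otherwise unfold the multiplication of polynomials. *)
HB.lock Definition taylor (k : fieldType) N (x : 'rV[k]_N)
    (p : {mpoly k[N]}) : {poly {mpoly k[N]}} :=
  mmap (polyC \o @mpolyC N k) (fun i => (x 0 i)%:MP%:P + ('X_i)%:P * 'X) p.

Section VanishingOrder.
Variable k : fieldType.

Fact taylor_additive N (x : 'rV[k]_N) : additive (taylor x).
Proof. by rewrite taylor.unlock => p q; rewrite mmapB. Qed.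

Fact taylor_multiplicative N (x : 'rV[k]_N) : multiplicative (taylor x).
Proof.
by rewrite taylor.unlock; split=> [p q|]; rewrite ?rmorphM ?rmorph1.
Qed.

HB.instance Definition _ N (x : 'rV[k]_N) :=
  GRing.isAdditive.Build _ _ (taylor x) (taylor_additive x).
HB.instance Definition _ N (x : 'rV[k]_N) :=
  GRing.isMultiplicative.Build _ _ (taylor x) (taylor_multiplicative x).

Lemma taylorC N (x : 'rV[k]_N) c : taylor x c%:MP = c%:MP%:P.
Proof. by rewrite taylor.unlock mmapC. Qed.

Lemma taylorX N (x : 'rV[k]_N) i :
  taylor x 'X_i = (x 0 i)%:MP%:P + ('X_i)%:P * 'X.
Proof. by rewrite taylor.unlock mmapX mmap1U. Qed.

Lemma taylor_linform N (x : 'rV[k]_N) a :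
  taylor x (linform a) = ((x *m a) 0 0)%:MP%:P + (linform a)%:P * 'X.
Proof.
rewrite rmorph_sum mxE !rmorph_sum mulr_suml -big_split; apply: eq_bigr => i _.
rewrite -mul_mpolyC rmorphM /= taylorC taylorX mulrDr.
by rewrite mulrC !rmorphM /= mulrA.
Qed.

Lemma taylor_lsubst N N' (M : 'M_(N', N)) (y : 'rV[k]_N') p :
  taylor y (lsubst M p) = map_poly (lsubst M) (taylor (y *m M) p).
Proof.
apply: (mpoly_rmorphism_ext (f := taylor y \o lsubst M)
  (g := map_poly (lsubst M) \o taylor (y *m M))) => [c|i] /=.
  by rewrite lsubstC !taylorC map_polyC /= lsubstC.
rewrite lsubstX taylorX taylor_linform rmorphD rmorphM /= map_polyX !map_polyC.
rewrite /= lsubstC lsubstX; congr (_%:MP%:P + _).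
by rewrite !mxE; apply: eq_bigr => j _; rewrite !mxE.
Qed.

(** The coefficient of index [i] is the homogeneous part of degree [i] of [p (x + X)]: this is
    multiplicity at least [h] at a vector of the affine cone. *)
Definition vanish_order N (x : 'rV[k]_N) h (p : {mpoly k[N]}) :=
  forall i, (i < h)%N -> (taylor x p)`_i = 0.

Lemma vanish_orderD N (x : 'rV[k]_N) h p q :
  vanish_order x h p -> vanish_order x h q -> vanish_order x h (p + q).
Proof.
move=> xp xq i lt.
by rewrite (raddfD (taylor x)) coefD (xp _ lt) (xq _ lt) addr0.
Qed.

Lemma vanish_orderM N (x : 'rV[k]_N) h h' p q :
  vanish_order x h p -> vanish_order x h' q -> vanish_order x (h + h') (p * q).
Proof.
move=> xp xq i lt; rewrite (rmorphM (taylor x)) coefM big1 // => j _.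
have [ltj|lej] := ltnP j h; first by rewrite xp ?mul0r.
by have ltji := ltn_ord j; rewrite xq ?mulr0 //; lia.
Qed.

Lemma vanish_order_lsubst N N' (M : 'M_(N', N)) y h p :
  vanish_order (y *m M) h p -> vanish_order y h (lsubst M p).
Proof.
by move=> yp i lt; rewrite taylor_lsubst coef_map (yp _ lt) /= raddf0.
Qed.

(** The form expands at [x] as [c + linform a * s], where [c] is its value. Dividing by it costs one
    order if [c = 0] and none otherwise. *)
Lemma vanish_order_linformM N (x : 'rV[k]_N) h a p :
  a != 0 -> vanish_order x h (p * linform a) ->
  vanish_order x (h - (x *m a == 0)) p.
Proof.
move=> nza; rewrite -linform_eq0 in nza.
have ->: (x *m a == 0) = ((x *m a) 0 0 == 0).
  apply/eqP/eqP=> [->|x0]; first by rewrite mxE.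
  by apply/matrixP=> i j; rewrite !ord1 x0 mxE.
rewrite /vanish_order (rmorphM (taylor x)) /= taylor_linform.
set c := (x *m a) 0 0; set q := taylor x p => qP.
have coefq i : (i < h)%N ->
    q`_i * c%:MP + (if i == 0%N then 0 else q`_i.-1 * linform a) = 0.
  by move/qP; rewrite mulrDr mulrA coefD coefMC coefMX coefMC.
have [c0|nzc] := eqVneq c 0.
  rewrite subn1 => i lt; have lt1: (i.+1 < h)%N by case: (h) lt.
  have := coefq _ lt1; rewrite c0 mpolyC0 mulr0 add0r /= => /eqP.
  rewrite mulf_eq0 (negPf nza) orbF.
  by move/eqP.
rewrite subn0; elim=> [|i IHi] lt; move: (coefq _ lt) => /=.
  rewrite addr0 => /eqP.
  by rewrite mulf_eq0 mpolyC_eq0 (negPf nzc) orbF => /eqP.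
rewrite IHi ?mul0r ?addr0 ?(ltnW lt) // => /eqP.
by rewrite mulf_eq0 mpolyC_eq0 (negPf nzc) orbF => /eqP.
Qed.

End VanishingOrder.

(** * Hyperplanes in general position *)

Lemma exists_card_between (T : finType) (S A : {set T}) m :
  S \subset A -> (#|S| <= m <= #|A|)%N ->
  exists s : {set T}, [/\ S \subset s, s \subset A & #|s| = m].
Proof.
move=> sSA /andP[leSm lemA].
have [r] := ubnP (m - #|S|); elim: r => // r IHr in S sSA leSm * => lt_r.
have [eqSm|neq] := eqVneq #|S| m; first by exists S.
have ltSA : (#|S| < #|A|)%N by lia.
have [x xA xS] : exists2 x, x \in A & x \notin S.
  have /properP[_ //] : S \proper A.
  by rewrite properEcard sSA.
have cU : #|x |: S| = #|S|.+1 by rewrite cardsU1 xS.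
have [|||s [sS sA cs]] := IHr (x |: S).
- by rewrite subUset sub1set xA.
- by rewrite cU; lia.
- by rewrite cU; lia.
by exists s; split=> //; apply: subset_trans sS; apply: subsetUr.
Qed.

(** Modulo [J], [f] agrees with the identity on generators, hence everywhere. With [f] the
    substitution of a projection, polynomials killed by [f] are thus in [J]. *)
Lemma is_ideal_mod_rmorphism (n : nat) (R : comNzRingType)
    (J : {mpoly R[n]} -> Prop) (f : {rmorphism {mpoly R[n]} -> {mpoly R[n]}}) :
  is_ideal J -> (forall c, f c%:MP = c%:MP) ->
  (forall i, J ('X_i - f 'X_i)) -> forall p, J (p - f p).
Proof.
case=> J0 JD JM fC fX.
have JfM p q : J (p - f p) -> J (q - f q) -> J (p * q - f (p * q)).
  move=> Jp Jq.
  have ->: p * q - f (p * q) = p * (q - f q) + f q * (p - f p).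
    by rewrite rmorphM !mulrBr addrA (mulrC (f q) p) subrK (mulrC (f q)).
  by apply: JD; apply: JM.
have JC c : J (c%:MP - f c%:MP) by rewrite fC subrr.
elim/mpolyind=> [|c m p _ _ IHp]; first by rewrite rmorph0 subrr.
rewrite rmorphD opprD addrACA; apply: JD => //.
rewrite -mul_mpolyC; apply: (JfM) => //; rewrite mpolyXE_id.
apply: (big_ind (fun q => J (q - f q))) => [||i _].
- by rewrite rmorph1 subrr.
- exact: JfM.
by elim: (m i) => [|e IHe]; rewrite ?expr0 ?rmorph1 ?subrr // exprS; apply: JfM.
Qed.

Section Hyperplanes.
Variable k : fieldType.

Lemma hyperplane_param N (a : 'cV[k]_N.+1) : a != 0 ->
  exists M : 'M_(N, N.+1),
    [/\ M *m a = 0, row_free M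
      & forall m (x : 'M_(m, N.+1)), x *m a = 0 -> (x <= M)%MS].
Proof.
move=> nza.
have rK : \rank (kermx a) = N.
  by rewrite mxrank_ker -[\rank a]mxrank_tr rank_rV trmx_eq0 nza subn1.
(* The rank occurs in the type of the basis, so the claim is proved for the rank first, which is
   then generalised and replaced by [N]. *)
have : exists M : 'M_(\rank (kermx a), N.+1),
    [/\ M *m a = 0, row_free M
      & forall m (x : 'M_(m, N.+1)), x *m a = 0 -> (x <= M)%MS].
  exists (row_base (kermx a)); split; last 1 first.
  - by move=> m x x0; rewrite eq_row_base; apply/sub_kermxP.
  - by apply/sub_kermxP; rewrite eq_row_base.
  - exact: row_base_free.
by move: (\rank _) rK => r ->.
Qed.

(** Substituting a projection onto the hyperplane changes each variable by a multiple of
    [linform a], and kills [p] because it factors through [M]. *)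
Lemma linform_dvd N N' (M : 'M[k]_(N', N)) (a : 'cV_N) p :
  a != 0 -> (forall m (x : 'M_(m, N)), x *m a = 0 -> (x <= M)%MS) ->
  lsubst M p = 0 -> exists q, p = q * linform a.
Proof.
move=> nza Mmax p0.
have [i nzi] : exists i, a i 0 != 0.
  apply/existsP; apply: contraNT nza => /existsPn a0.
  by apply/eqP/colP=> i; rewrite mxE; have /negPn/eqP := a0 i.
have [u ua] : exists u : 'rV_N, u *m a = 1.
  exists ((a i 0)^-1 *: delta_mx 0 i).
  apply/matrixP=> ? ?; rewrite !ord1 -scalemxAl -rowE mxE [row i a _ _]mxE.
  by rewrite mulVf // mxE eqxx.
pose Pi := 1%:M - a *m u.
have /submxP[C defPi] : (Pi <= M)%MS.
  by apply: Mmax; rewrite mulmxBl mul1mx -mulmxA ua mulmx1 subrr.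
pose J q := exists r, q = r * linform a.
have idJ : is_ideal J.
  split=> [|_ _ [r ->] [s ->]|b _ [r ->]]; first by exists 0; rewrite mul0r.
    by exists (r + s); rewrite mulrDl.
  by exists (b * r); rewrite mulrA.
have Pip0 : lsubst Pi p = 0 by rewrite defPi -lsubst_comp p0 raddf0.
rewrite -[p]subr0 -Pip0.
apply: (is_ideal_mod_rmorphism (f := lsubst Pi) idJ (lsubstC Pi)) => j.
exists (u 0 j)%:MP; rewrite /= lsubstX -linform_delta -scaleN1r -linformZ.
rewrite -linformD mul_mpolyC -linformZ; congr linform.
apply/colP=> l; rewrite !mxE big_ord1 eqxx andbT.
by rewrite mulN1r opprB addrC subrK mulrC.
Qed.

(** On the hyperplane of [a i] the product already split off stays nonzero, by the separating
    vectors, so the cofactor must vanish there. *)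
Lemma prod_linform_dvd N (I : eqType) (s : seq I) (a : I -> 'cV[k]_N.+1) p :
    uniq s -> {in s, forall i, a i != 0} ->
    {in s &, forall i j, i != j -> exists2 x : 'rV_N.+1,
       x *m a i = 0 & x *m a j != 0} ->
    {in s, forall i, exists q, p = q * linform (a i)} ->
  exists q, p = q * \prod_(i <- s) linform (a i).
Proof.
elim: s => [|i s IHs] /=; first by exists p; rewrite big_nil mulr1.
case/andP=> is' us nz sep dvd.
have [|||q defp] := IHs us.
- by move=> j js; apply: nz; rewrite inE js orbT.
- by move=> j l js ls; apply: sep; rewrite inE ?js ?ls orbT.
- by move=> j js; apply: dvd; rewrite inE js orbT.
have nzi : a i != 0 by apply: nz; rewrite mem_head.
have [M [Ma _ Mmax]] := hyperplane_param nzi.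
have q0 : lsubst M q = 0.
  have [r defr] := dvd i (mem_head _ _).
  have: lsubst M p = 0.
    by rewrite defr rmorphM /= lsubst_linform Ma linform0 mulr0.
  rewrite defp rmorphM rmorph_prod /= => /eqP; rewrite mulf_eq0.
  case/orP=> [/eqP //|]; rewrite prodf_seq_eq0 => /hasP[j js].
  rewrite /= lsubst_linform linform_eq0 => /eqP Maj0.
  have [||x xi /eqP[]] := sep i j (mem_head _ _).
  - by rewrite inE js orbT.
  - by apply: contraNneq is' => ->.
  by have /submxP[c ->] := Mmax _ _ xi; rewrite -mulmxA Maj0 mulmx0.
have [r defq] := linform_dvd nzi Mmax q0.
by exists r; rewrite defp defq big_cons mulrA.
Qed.

Lemma prod_linform_homog N I (s : seq I) (a : I -> 'cV[k]_N) :
  \prod_(i <- s) linform (a i) \is (size s).-homog.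
Proof.
elim: s => [|i s IHs]; first by rewrite big_nil dhomog1.
by rewrite big_cons -[size _]add1n dhomogM // linform_homog.
Qed.

Lemma vanish_order_prod_linform N (I : eqType) (s : seq I)
    (a : I -> 'cV[k]_N) x h p :
  {in s, forall i, a i != 0} ->
  vanish_order x h (p * \prod_(i <- s) linform (a i)) ->
  vanish_order x (h - count (fun i => x *m a i == 0) s) p.
Proof.
move=> nza; elim: s => [|i s IHs] in h nza *.
  by rewrite big_nil mulr1 subn0.
have nzi : a i != 0 by apply: nza; rewrite mem_head.
rewrite big_cons mulrCA mulrC => /(vanish_order_linformM nzi)/IHs /=.
by rewrite subnDA; apply=> j js; apply: nza; rewrite inE js orbT.
Qed.

(** Projectively, no [N] of these hyperplanes in dimension [N - 1] have a common point. The index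
    set [A] is a parameter because it shrinks on restriction. *)
Definition general_position N (T : finType) (a : T -> 'cV[k]_N) (A : {set T}) :=
  forall s : {set T}, s \subset A -> #|s| = N ->
  forall x : 'rV_N, (forall i, i \in s -> x *m a i = 0) -> x = 0.

Section GeneralPosition.
Variables (N : nat) (T : finType) (a : T -> 'cV[k]_N.+2) (A : {set T}).
Hypotheses (gpA : general_position a A) (leA : (N.+2 <= #|A|)%N).

(** Among [N.+2] indices including [i] and [j], the [N.+1] forms other than that of [j] have a
    nonzero common zero; general position keeps the form of [j] from vanishing there. *)
Lemma general_position_sep i j : i \in A -> j \in A -> i != j ->
  exists2 x : 'rV_N.+2, x *m a i = 0 & x *m a j != 0.
Proof.
move=> iA jA ne.
have [||s [sij sA cs]] := @exists_card_between _ [set i; j] A N.+2.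
- by rewrite subUset !sub1set iA.
- by rewrite cards2 ne.
have [is' js] : i \in s /\ j \in s.
  by split; apply: (subsetP sij); rewrite !inE eqxx ?orbT.
pose C := \matrix_(l < N.+2, m < #|s :\ j|) a (enum_val m) l 0.
have: kermx C != 0.
  rewrite -mxrank_eq0 mxrank_ker subn_eq0 -ltnNge.
  apply: leq_ltn_trans (rank_leq_col C) _.
  by have := cardsD1 j s; rewrite js cs; lia.
move/rowV0Pn=> [x /sub_kermxP xC nzx].
have x0 m : m \in s :\ j -> x *m a m = 0.
  move=> ms; apply/matrixP=> p q; rewrite !ord1 !mxE.
  have /rowP/(_ (enum_rank_in ms m)) := xC; rewrite !mxE.
  by apply: etrans; apply: eq_bigr => l _; rewrite mxE enum_rankK_in.
exists x; first by apply: x0; rewrite !inE ne.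
apply: contraNneq nzx => xj; apply/eqP; apply: (gpA sA cs) => m ms.
by have [->//|nm] := eqVneq m j; apply: x0; rewrite !inE nm.
Qed.

Lemma general_position_neq0 i : i \in A -> a i != 0.
Proof.
move=> iA; have: (0 < #|A :\ i|)%N by have := cardsD1 i A; rewrite iA; lia.
case/card_gt0P=> j; rewrite !inE => /andP[ne jA].
have [x _] := general_position_sep jA iA ne.
by apply: contraNneq => ->; rewrite mulmx0.
Qed.

Lemma general_position_zeros (x : 'rV_N.+2) : x != 0 ->
  (#|[set i in A | x *m a i == 0%R]| <= N.+1)%N.
Proof.
move=> nzx; rewrite leqNgt; apply: contraNN nzx => lt.
pose Z := [set i in A | x *m a i == 0].
have [||s [_ sZ cs]] := @exists_card_between _ set0 Z N.+2.
- exact: sub0set.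
- by rewrite cards0.
apply/eqP; apply: (gpA _ cs) => [|i /(subsetP sZ)].
  by apply: subset_trans sZ _; apply/subsetP=> i; rewrite inE => /andP[].
by rewrite inE => /andP[_ /eqP].
Qed.

Lemma general_position_restrict i (M : 'M_(N.+1, N.+2)) :
  i \in A -> M *m a i = 0 -> row_free M ->
  general_position (fun j => M *m a j) (A :\ i).
Proof.
move=> iA Mi fM s sA cs y ys; apply: (row_free_inj fM); rewrite mul0mx.
have is' : i \notin s by apply/negP=> /(subsetP sA); rewrite !inE eqxx.
apply: (gpA (s := i |: s)).
- rewrite subUset sub1set iA; apply: subset_trans sA _; exact: subD1set.
- by rewrite cardsU1 is' cs.
move=> j; rewrite !inE -mulmxA => /predU1P[->|js]; last exact: ys.
by rewrite Mi mulmx0.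
Qed.

(* If every form in the family must be divisible by each [a i], divide by their
   product: the degree drops by [#|A|] and the multiplicities by at most [c],
   which preserves the inequality. *)
Lemma descent (X : 'rV[k]_N.+2 -> Prop) (c : nat) :
    (forall x, X x -> (#|[set i in A | x *m a i == 0%R]| <= c)%N) ->
    (forall d h F, F \is d.-homog -> (forall x, X x -> vanish_order x h F) ->
       (c * d < h * #|A|)%N ->
       forall i, i \in A -> exists q, F = q * linform (a i)) ->
  forall d h F, F \is d.-homog -> (forall x, X x -> vanish_order x h F) ->
    (c * d < h * #|A|)%N -> F = 0.
Proof.
move=> Xc dvd d; have [m] := ubnP d; elim: m d => // m IHm d lt_dm h F FP FX lt.
apply/eqP/negPn/negP=> nzF.
have [||||q defF] := @prod_linform_dvd _ _ (enum A) a F.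
- exact: enum_uniq.
- by move=> i; rewrite mem_enum; apply: general_position_neq0.
- by move=> i j; rewrite !mem_enum; apply: general_position_sep.
- by move=> i; rewrite mem_enum; apply: dvd FP FX lt i.
set P := \prod_(i <- _) _ in defF.
have PP : P \is #|A|.-homog by rewrite cardE; apply: prod_linform_homog.
have FPq : F = P * q by rewrite mulrC.
have [leAd qP] : (#|A| <= d)%N /\ q \is (d - #|A|).-homog.
  by apply: homog_cofactor PP; rewrite -FPq.
suff q0 : q = 0 by rewrite defF q0 mul0r eqxx in nzF.
apply: (IHm (d - #|A|)%N _ (h - c)%N) => //; first by lia.
  move=> x Xx.
  have nza i : i \in enum A -> a i != 0.
    by rewrite mem_enum; apply: general_position_neq0.
  have := FX x Xx; rewrite defF => /(vanish_order_prod_linform nza).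
  move=> q0 l lt_l; apply: q0; apply: leq_trans lt_l _.
  rewrite leq_sub2l // -size_filter; apply: leq_trans _ (Xc x Xx).
  rewrite cardE; apply: eq_leq; congr size.
  rewrite /enum_mem -filter_predI; apply: eq_filter => i.
  by rewrite /= inE andbC.
(* As [c * #|A| <= c * d], subtracting [c * #|A|] from both sides keeps the inequality strict
   despite truncation. *)
by rewrite mulnBr mulnBl; have := leq_mul2l c #|A| d; rewrite leAd orbT; lia.
Qed.

End GeneralPosition.

End Hyperplanes.

(** * Forms vanishing on a star configuration with a few points removed *)

Section LowerBound.
Variables (k : fieldType) (T : finType).

Lemma taylor_coef0 N (x : 'rV[k]_N) p :
  (taylor x p)`_0 = (p.@[fun i => x 0 i])%:MP.
Proof.
apply: (mpoly_rmorphism_ext (f := coefp 0 \o taylor x)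
  (g := @mpolyC N k \o meval (fun i => x 0 i))) => [c|i] /=.
  by rewrite taylorC mevalC coefC.
by rewrite taylorX mevalXU coefD coefMX coefC addr0.
Qed.

Lemma homog_univariate_eq0 d (p : {mpoly k[1]}) :
  p \is d.-homog -> p.@[fun=> 1] = 0 -> p = 0.
Proof.
move=> pP p1; pose m := [multinom d | i < 1].
have defp : p = p@_m *: 'X_[m].
  apply/mpolyP=> m'; rewrite mcoeffZ mcoeffX.
  case: eqP => [<-|ne]; rewrite ?mulr1 // mulr0 (dhomog_nemf_coeff pP) //.
  apply/eqP=> dm'; apply: ne; apply/mnmP=> i; rewrite ord1 mnmE -dm'.
  by rewrite [LHS]mdegE big_ord1.
move: p1; rewrite defp mevalZ mevalX big1 => [|i _]; last exact: expr1n.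
by rewrite mulr1 => ->; rewrite scale0r.
Qed.

(** On a line the hyperplanes are points, and at most one form vanishes at a nonzero vector, so the
    descent runs with [c = 1]. *)
Lemma vanishing_on_line (a : T -> 'cV[k]_2) (A : {set T}) d h F :
    general_position a A -> (2 <= #|A|)%N -> F \is d.-homog ->
    (forall x : 'rV_2, x != 0 -> (exists2 i, i \in A & x *m a i = 0) ->
       vanish_order x h F) ->
  (d < h * #|A|)%N -> F = 0.
Proof.
move=> gpA leA FP FX lt.
apply: (descent gpA leA (c := 1)
  (X := fun x => x != 0 /\ exists2 i, i \in A & x *m a i = 0)) FP _ _.
- by move=> x [nzx _]; apply: general_position_zeros gpA x nzx.
- move=> {h F FX lt}d h F FP FX lt i iA.
  have nzi := general_position_neq0 gpA leA iA.
  have [M [Ma fM Mmax]] := hyperplane_param nzi.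
  apply: linform_dvd nzi Mmax _.
  apply: homog_univariate_eq0 (lsubst_homog M FP) _.
  have nzM : M != 0.
    by apply: contraTneq fM => ->; rewrite /row_free mxrank0.
  have h_gt0 : (0 < h)%N by case: (h) lt; rewrite ?mul0n.
  have := FX M (conj nzM (ex_intro2 _ _ i iA Ma)).
  (* [M] is a single row, the point itself; as [1 *m M] it turns the value of [F] there into that of
     the restriction at 1. *)
  rewrite -[M in X in X -> _]mul1mx.
  move/vanish_order_lsubst/(_ 0%N h_gt0)/eqP; rewrite taylor_coef0 mpolyC_eq0.
  move=> /eqP; congr (_ = _); apply: meval_eq => j.
  by rewrite ord1 mxE eqxx.
- by move=> x []; apply: FX.
- by rewrite mul1n.
Qed.

(** Points of the star configuration of [A] are given by all their nonzero vectors. [B] is any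
    family of sets, so that traces on hyperplanes keep this shape. *)
Definition vanish_off n (a : T -> 'cV[k]_n.+1) (A : {set T})
    (B : {set {set T}}) h F :=
  forall s : {set T}, s \subset A -> #|s| = n -> s \notin B ->
  forall x : 'rV_n.+1, x != 0 -> (forall i, i \in s -> x *m a i = 0) ->
  vanish_order x h F.

(** At most [n.+1] hyperplanes pass through a point, which is the [c] of the descent. On the
    hyperplane of [i], the family [B] becomes its link at [i]. *)
Lemma vanish_off_by_restriction n (a : T -> 'cV[k]_n.+2) (A : {set T})
    (B : {set {set T}}) :
    general_position a A -> (n.+2 <= #|A|)%N ->
    (forall i (M : 'M_(n.+1, n.+2)) d h G,
       i \in A -> general_position (fun j => M *m a j) (A :\ i) ->
       G \is d.-homog ->
       vanish_off (fun j => M *m a j) (A :\ i)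
         [set s : {set T} | (i \notin s) && (i |: s \in B)] h G ->
       (n.+1 * d < h * #|A|)%N -> G = 0) ->
  forall d h F, F \is d.-homog -> vanish_off a A B h F ->
    (n.+1 * d < h * #|A|)%N -> F = 0.
Proof.
move=> gpA leA IH d h F FP FX lt.
pose X (x : 'rV[k]_n.+2) := x != 0 /\
  exists s : {set T}, [/\ s \subset A, #|s| = n.+1, s \notin B
    & forall i, i \in s -> x *m a i = 0].
apply: (descent gpA leA (X := X) _ _ FP _ lt).
- by move=> x [nzx _]; apply: general_position_zeros gpA x nzx.
- move=> {h F FP FX lt}d h F FP FX lt i iA.
  have nzi := general_position_neq0 gpA leA iA.
  have [M [Ma fM Mmax]] := hyperplane_param nzi.
  apply: linform_dvd nzi Mmax _.
  have gpM := general_position_restrict gpA iA Ma fM.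
  apply: (IH i M d h) => //; first exact: lsubst_homog FP.
  move=> s sA cs; rewrite inE => sB y nzy ys.
  have is' : i \notin s by apply/negP=> /(subsetP sA); rewrite !inE eqxx.
  rewrite is' in sB; apply: vanish_order_lsubst; apply: FX; split.
    apply: contraNneq nzy => yM0; apply/eqP/(row_free_inj fM).
    by rewrite yM0 mul0mx.
  exists (i |: s); split=> //.
  + rewrite subUset sub1set iA; apply: subset_trans sA _; exact: subD1set.
  + by rewrite cardsU1 is' cs.
  + by move=> j /setU1P[->|js]; rewrite -mulmxA ?Ma ?mulmx0 // ys.
- by move=> x [nzx [s [sA cs sB xs]]]; apply: FX xs.
Qed.

(** Induction on the projective dimension [n.+2]: in the link at [i], intersections lose the element
    [i], so sparsity is inherited. The case [n = 0] restricts from the plane to lines. *)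
Theorem vanish_off_sparse_eq0 n (a : T -> 'cV[k]_n.+3) (A : {set T})
    (B : {set {set T}}) d h F :
    general_position a A -> (n.+4 <= #|A|)%N ->
    (forall b b', b \in B -> b' \in B -> (n < #|b :&: b'|)%N -> b = b') ->
    F \is d.-homog -> vanish_off a A B h F ->
  (n.+2 * d < h * #|A|)%N -> F = 0.
Proof.
elim: n => [|n IHn] in a A B d h F *; move=> gpA leA BP;
  apply: (vanish_off_by_restriction gpA (ltnW leA)) => {d h F} i M d h F;
  move=> iA gpM FP FX lt; have cA : #|A| = #|A :\ i|.+1
    by rewrite (cardsD1 i A) iA.
  (* These are the points kept on the line of [i]. For [n = 0], members of [B] containing [i]
     coincide, so at most one point is lost. *)
  pose A' := [set j in A :\ i | [set i; j] \notin B].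
  have sA' : A' \subset A :\ i by apply/subsetP=> j; rewrite inE => /andP[].
  have le1 : (#|(A :\ i) :\: A'| <= 1)%N.
    apply/card_le1_eqP=> j l; rewrite !inE.
    case/andP=> jB /andP[nj jA]; rewrite nj jA /= negbK in jB.
    case/andP=> lB /andP[nl lA]; rewrite nl lA /= negbK in lB.
    have eB : [set i; j] = [set i; l].
      by apply: BP => //; apply/card_gt0P; exists i; rewrite !inE eqxx.
    by have := set22 i j; rewrite eB !inE (negPf nj) => /eqP.
  have leA' : (#|A :\ i| <= #|A'|.+1)%N.
    by rewrite -(cardsID A' (A :\ i)) (setIidPr sA') -addn1 leq_add2l.
  apply: (vanishing_on_line (a := fun j => M *m a j) (A := A')) FP _ _.
  - move=> s sA; apply: gpM; exact: subset_trans sA sA'.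
  - lia.
  - move=> x nzx [j jA' xj]; move: (jA'); rewrite inE => /andP[jA jB].
    apply: (FX [set j]) => //; rewrite ?sub1set ?cards1 //.
      by rewrite !inE (negPf jB) andbF.
    by move=> l /set1P->.
  (* [#|A'| >= #|A| - 2], which is at least half of [#|A|] because [#|A| >= 4]. *)
  - nia.
apply: (IHn _ _ _ _ _ _ gpM _ _ FP FX).
- by rewrite -ltnS -cA.
- move=> b b'; rewrite !inE => /andP[ib bB] /andP[ib' bB'] le.
  rewrite -(setU1K ib) -(setU1K ib') (BP _ _ bB bB') //.
  by rewrite -setUIr cardsU1 inE negb_and ib.
(* Uses [n.+2 * #|A| <= n.+3 * (#|A| - 1)], true once [#|A| >= n.+3]. *)
- nia.
Qed.

End LowerBound.

(** * Ideals of points and Steiner systems *)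

Section Ideals.
Variable R : comNzRingType.
Implicit Types (I J P S : R -> Prop) (f g : R).

Lemma gen_ideal_is_ideal S : is_ideal (gen_ideal S).
Proof.
split=> [J [] //|f g Sf Sg J idJ SJ|a f Sf J idJ SJ]; case: (idJ) => _ JD JM.
  by apply: JD; [apply: Sf | apply: Sg].
by apply: JM; apply: Sf.
Qed.

Lemma gen_ideal_mem S f : S f -> gen_ideal S f.
Proof. by move=> Sf J _; apply. Qed.

Lemma is_ideal_sum J (T : Type) (r : seq T) (F : T -> R) :
  is_ideal J -> (forall i, J (F i)) -> J (\sum_(i <- r) F i).
Proof. by case=> J0 JD _ JF; apply: (big_ind J) => // i _; apply: JF. Qed.

Lemma exp_ideal_exp P f m : P f -> exp_ideal P m (f ^+ m).
Proof.
move=> Pf; elim: m => //= m IHm; apply: gen_ideal_mem.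
by exists f, (f ^+ m); rewrite exprS.
Qed.

Lemma associated_prime_contains I P f :
  is_ideal I -> associated_prime I P -> I f -> P f.
Proof.
by case=> _ _ IM [_ [g Pg]] If; apply/Pg; rewrite mulrC; apply: IM.
Qed.

End Ideals.

(** * Intersections of blocks and the size of a Steiner system *)

Lemma steiner_system_card_inter (V : finType) (B : {set {set V}}) (t n v : nat)
    b b' : steiner_system B t n v -> b \in B -> b' \in B ->
  (t <= #|b :&: b'|)%N -> b = b'.
Proof.
case=> _ _ SB bB b'B le.
have [||s [_ sbb cs]] := @exists_card_between _ set0 (b :&: b') t.
- exact: sub0set.
- by rewrite cards0.
have [c [_ cP]] := SB s cs; move: sbb; rewrite subsetI => /andP[sb sb'].
by rewrite -(cP b) // -(cP b').
Qed.

(** Blocks cover [V] since [t > 0], and no block is all of [V] because of [s], so there are two of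
    them. They share at most [n - 2] elements, so their union has at least [n + 2]. *)
Lemma steiner_system_large (V : finType) (B : {set {set V}}) (t n v : nat)
    (s : {set V}) :
  steiner_system B t n v -> (0 < t < n)%N -> #|s| = n -> s \notin B ->
  (n.+2 <= v)%N.
Proof.
move=> SB /andP[t0 ltn] cs sB; case: (SB) => cV cB exB.
have le_nv : (n <= v)%N by rewrite -cs -cV max_card.
have block x : exists2 b, b \in B & x \in b.
  have [||T [xT _ cT]] := @exists_card_between _ [set x] setT t.
  - exact: subsetT.
  - by rewrite cards1 cardsT cV t0; lia.
  have [b [[bB Tb] _]] := exB T cT.
  by exists b => //; apply: (subsetP Tb); rewrite -sub1set.
have [x0 x0s] : exists x, x \in s by apply/card_gt0P; lia.
have [b bB _] := block x0.
have [|x _ xb] := @subsetPn _ setT b _.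
  apply: contraNN sB => Tb; have -> : s = b; last by [].
  apply/eqP; rewrite eqEcard cs (cB b bB) leqnn andbT.
  by apply: subset_trans Tb; apply: subsetT.
have [b' b'B xb'] := block x.
have ne : b != b' by apply: contraNneq xb => ->.
rewrite leqNgt; apply: contraNN ne => lt; apply/eqP.
apply: (steiner_system_card_inter SB bB b'B).
have := cardsUI b b'; rewrite (cB b bB) (cB b' b'B).
have : (#|b :|: b'| <= v)%N by rewrite -cV max_card.
lia.
Qed.

(** * Points of the arrangement, their ideals, and the ideal of the complement *)

Section Configuration.
Variables (k : fieldType) (n v : nat) (a : 'I_v -> 'cV[k]_n.+1).
Let l j := linform (a j).

Fact dim_vline_eq1 (x : 'rV[k]_n.+1) : x != 0 -> \dim <[x]> == 1%N.
Proof. by rewrite dim_vline => ->. Qed.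

Definition line_point (x : 'rV[k]_n.+1) (nzx : x != 0) : proj_point k n :=
  exist _ <[x]>%VS (dim_vline_eq1 nzx).

Lemma line_point_in_intersection (s : {set 'I_v}) x (nzx : x != 0) :
  (forall j, j \in s -> x *m a j = 0) -> in_intersection l s (line_point nzx).
Proof.
move=> xs j js y /vlineP[c ->].
by rewrite /l linform_meval -scalemxAl xs // scaler0 mxE.
Qed.

Lemma in_intersection_mulmx (s : {set 'I_v}) p x j :
  in_intersection l s p -> x \in val p -> j \in s -> x *m a j = 0.
Proof.
move=> ps xp js; apply/matrixP=> i i'; rewrite !ord1 [RHS]mxE -linform_meval.
exact: (ps j js x xp).
Qed.

Lemma proj_point_vector (p : proj_point k n) :
  exists2 x, x != 0 & val p = <[x]>%VS.
Proof.
case: p => /= W /eqP dW; exists (vpick W).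
  by rewrite vpick0 -dimv_eq0 dW.
apply/eqP; rewrite eq_sym eqEdim -memvE memv_pick dim_vline vpick0 -dimv_eq0.
by rewrite dW.
Qed.

Hypothesis arrH : hyperplane_arrangement l.

Lemma arrangement_general_position : general_position a setT.
Proof.
case: arrH => _ _ _ H4 s _ cs x xs; apply/eqP/negPn/negP=> nzx.
by case: (H4 s cs); exists (line_point nzx); apply: line_point_in_intersection.
Qed.

Lemma arrangement_neq0 j : a j != 0.
Proof. by case: arrH => /(_ j)[_ +] _ _ _; rewrite linform_eq0. Qed.

(** Every nonzero common zero spans a point of the intersection; uniqueness of that point makes the
    space of zeros one-dimensional. *)
Lemma arrangement_point (s : {set 'I_v}) : #|s| = n ->
  exists x : 'rV_n.+1, [/\ x != 0, forall j, j \in s -> x *m a j = 0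
    & forall y : 'rV_n.+1, (forall j, j \in s -> y *m a j = 0) -> (y <= x)%MS].
Proof.
case: arrH => _ _ /(_ s) + _ cs; move/(_ cs)=> [p [ps puniq]].
have [x nzx defp] := proj_point_vector p.
exists x; split=> // [j|y ys].
  by apply: in_intersection_mulmx ps _; rewrite defp memv_line.
have [->|nzy] := eqVneq y 0; first exact: sub0mx.
have eq_p := puniq _ (line_point_in_intersection (nzx := nzy) ys).
have : y \in val p by rewrite eq_p memv_line.
by rewrite defp => /vlineP[c ->]; apply: scalemx_sub.
Qed.

(* The point ideal is the kernel of the restriction to the line of [k^(n+1)]
   spanned by [x], which takes values in an integral domain. *)
Lemma point_idealP (s : {set 'I_v}) (x : 'rV_n.+1) f :
    (forall j, j \in s -> x *m a j = 0) ->
    (forall y : 'rV_n.+1, (forall j, j \in s -> y *m a j = 0) -> (y <= x)%MS) ->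
  point_ideal l s f <-> lsubst x f = 0.
Proof.
move=> xs xmax; split=> [|f0].
  move/(_ (fun g => lsubst x g = 0)); apply; last first.
    by move=> g [j js ->]; rewrite lsubst_linform xs // linform0.
  split=> [|g h g0 h0|g h h0]; first by rewrite raddf0.
    by rewrite raddfD /= g0 h0 addr0.
  by rewrite rmorphM /= h0 mulr0.
pose A := \matrix_(i < n.+1, m < #|s|) a (enum_val m) i 0.
(* Since [A *m pinvmx A *m A = A], the rows of [Pi] are common zeros, hence multiples of [x]; [Pi]
   moves each variable by a combination of the forms of [s]. *)
pose Pi := 1%:M - A *m pinvmx A.
have colA m : col m A = a (enum_val m) by apply/colP=> i; rewrite !mxE.
have PiA : Pi *m A = 0 by rewrite mulmxBl mul1mx mulmxKpV // subrr.
have /submxP[C defPi] : (Pi <= x)%MS.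
  apply/row_subP=> i; apply: xmax => j js.
  rewrite -(enum_rankK_in js js) -colA colE mulmxA -row_mul PiA.
  by rewrite row0 mul0mx.
have Pif0 : lsubst Pi f = 0 by rewrite defPi -lsubst_comp f0 raddf0.
rewrite -[f]subr0 -Pif0; set J := point_ideal l s.
have idJ : is_ideal J by apply: gen_ideal_is_ideal.
apply: (is_ideal_mod_rmorphism (f := lsubst Pi) idJ (lsubstC Pi)) => i /=.
have ->: 'X_i - lsubst Pi 'X_i = \sum_m (pinvmx A m i)%:MP * l (enum_val m).
  rewrite lsubstX -linform_delta -scaleN1r -linformZ -linformD.
  under eq_bigr do rewrite mul_mpolyC -linformZ.
  rewrite -linform_sum; congr linform.
  apply/colP=> r; rewrite summxE !mxE eqxx andbT mulN1r opprB addrC subrK.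
  by apply: eq_bigr => m _; rewrite !mxE mulrC.
apply: (is_ideal_sum _ idJ) => m; case: (idJ) => _ _; apply.
by apply: gen_ideal_mem; exists (enum_val m) => //; apply: enum_valP.
Qed.

Lemma point_ideal_prime (s : {set 'I_v}) :
  #|s| = n -> prime_ideal (point_ideal l s).
Proof.
move=> cs; have [x [_ xs xmax]] := arrangement_point cs.
have P f := point_idealP f xs xmax.
split; first exact: gen_ideal_is_ideal.
  by move/P/eqP; rewrite rmorph1 oner_eq0.
move=> f g /P/eqP; rewrite rmorphM mulf_eq0 => /orP[]/eqP/P; tauto.
Qed.

(** Vanishing to a given order at [x] defines an ideal and orders add in products, so only the
    generators, which vanish at [x], need checking. *)
Lemma exp_point_ideal_vanish (s : {set 'I_v}) m f (x : 'rV_n.+1) :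
  (forall j, j \in s -> x *m a j = 0) ->
  exp_ideal (point_ideal l s) m f -> vanish_order x m f.
Proof.
move=> xs.
have ideal_vanish h : is_ideal (vanish_order x h).
  split=> [i _|f1 f2|f1 f2 f2h]; first by rewrite raddf0 coef0.
    exact: vanish_orderD.
  by apply: (vanish_orderM (h := 0)).
elim: m f => //= m IHm f /(_ (vanish_order x m.+1)).
apply; first exact: ideal_vanish.
move=> _ [g [h [gs /IHm hm ->]]]; apply: (vanish_orderM (h := 1)) hm.
apply: (gs (vanish_order x 1)); first exact: ideal_vanish.
move=> _ [j js ->] [|//] _; rewrite taylor_coef0 linform_meval xs //.
by rewrite mxE mpolyC0.
Qed.

Variable B : {set {set 'I_v}}.
Let I := complement_ideal l B.

Lemma complement_ideal_is_ideal : is_ideal I.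
Proof.
split=> [s sB|f g If Ig s sB|f g Ig s sB];
  have [J0 JD JM] := gen_ideal_is_ideal (fun f => exists2 j, j \in s & f = l j).
- exact: J0.
- by apply: JD; [apply: If|apply: Ig].
- by apply: JM; apply: Ig.
Qed.

Lemma prod_point_ideal (s S : {set 'I_v}) j :
  j \in s -> j \in S -> point_ideal l s (\prod_(i in S) l i).
Proof.
move=> js jS; rewrite (bigD1 j) //= mulrC.
have [_ _] := gen_ideal_is_ideal (fun f => exists2 j, j \in s & f = l j).
by apply; apply: gen_ideal_mem; exists j.
Qed.

Lemma complement_blocksP s :
  s \in complement_blocks n B <-> #|s| = n /\ s \notin B.
Proof.
rewrite !inE; split=> [/andP[sB /eqP cs] //|[-> ->]]; by rewrite eqxx.
Qed.

(** The witness is the product of the forms outside [s]: it lies in the ideal of every other point,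
    but no factor vanishes at the point of [s]. *)
Lemma point_ideal_associated s :
  s \in complement_blocks n B -> associated_prime I (point_ideal l s).
Proof.
move=> sC; have /complement_blocksP[cs sB] := sC.
split; first exact: point_ideal_prime.
have [x [nzx xs xmax]] := arrangement_point cs.
have P f := point_idealP f xs xmax.
have [_ _ JM] := gen_ideal_is_ideal (fun f => exists2 j, j \in s & f = l j).
exists (\prod_(j in ~: s) l j) => g; split=> [gs s' s'C|/(_ s sC)].
  have [->|ne] := eqVneq s' s; first by rewrite mulrC; apply: JM.
  have /complement_blocksP[cs' _] := s'C.
  have /subsetPn[j js' js] : ~~ (s' \subset s).
    by apply: contraNN ne => ss; rewrite eqEcard ss cs cs' leqnn.
  have [_ _] := gen_ideal_is_ideal (fun f => exists2 j, j \in s' & f = l j).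
  by apply; apply: prod_point_ideal js' _; rewrite inE.
move/P/eqP; rewrite rmorphM mulf_eq0 rmorph_prod /= => /orP[/eqP/P //|].
case/prodf_eq0=> j; rewrite inE lsubst_linform linform_eq0 => js /eqP xj.
case/eqP: nzx; apply: (arrangement_general_position (s := j |: s)).
- exact: subsetT.
- by rewrite cardsU1 js cs.
by move=> i /setU1P[->|] //; apply: xs.
Qed.

Lemma prod_forms_homog_neq0 (S : {set 'I_v}) :
  \prod_(i in S) l i \is #|S|.-homog /\ \prod_(i in S) l i != 0.
Proof.
split; first by rewrite -big_enum cardE prod_linform_homog.
by apply/prodf_neq0=> i _; rewrite linform_eq0 arrangement_neq0.
Qed.

Lemma alpha_complement_ideal_le : (0 < n <= v)%N -> (alpha I <= (v - n).+1)%N.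
Proof.
case/andP=> n0 le_nv.
have [S cS] : exists S : {set 'I_v}, #|S| = (v - n).+1.
  have [||S [_ _ cS]] := @exists_card_between _ set0 [set: 'I_v] (v - n).+1.
  - exact: sub0set.
  - rewrite cards0 cardsT card_ord /=; lia.
  by exists S.
have [PS nzS] := prod_forms_homog_neq0 S; rewrite cS in PS.
have nzI : nonzero_in_degree I (v - n).+1.
  exists (\prod_(i in S) l i); split=> // s /complement_blocksP[cs _].
  (* The sizes of [s] and [S] add up to [v + 1], so they meet. *)
  have [j] : exists j, j \in s :&: S.
    apply/card_gt0P; have := cardsUI s S; rewrite cs cS.
    have : (#|s :|: S| <= v)%N by rewrite -[X in (_ <= X)%N]card_ord max_card.
    lia.
  by rewrite inE => /andP[js jS]; apply: prod_point_ideal js jS.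
by have [_ ->] := alphaP (ex_intro _ _ nzI).
Qed.

(** [alpha] is chosen by [epsilon], so a nonzero form is needed: the [h]-th power of the product of
    all forms. That product is in [I] because each [s] is nonempty. *)
Lemma alpha_symbolic_power_complement :
  (0 < n)%N ->
  forall h, least_degree (symbolic_power I h) (alpha (symbolic_power I h)).
Proof.
move=> n0 h; apply: alphaP; exists (v * h)%N.
exists ((\prod_(i in [set: 'I_v]) l i) ^+ h).
have [pP nzp] := prod_forms_homog_neq0 setT; rewrite cardsT card_ord in pP.
split; [|exact: dhomogMn|by rewrite expf_neq0].
move=> P assP; apply: exp_ideal_exp.
apply: associated_prime_contains complement_ideal_is_ideal assP _ => s.
case/complement_blocksP=> cs _.
have [j js] : exists j, j \in s by apply/card_gt0P; rewrite cs.
exact: prod_point_ideal js (in_setT _).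
Qed.

End Configuration.

(** * Chudnovsky's inequality for the complement of a Steiner configuration *)

Theorem corollary3p7 (k : closedFieldType) (char0 : [pchar k] =i pred0)
    (t n v : nat) (t_gt0 : (0 < t)%N) (lt_tn : (t < n)%N) (le_nv : (n <= v)%N)
    (B : {set {set 'I_v}}) (steinerB : steiner_system B t n v)
    (l : 'I_v -> {mpoly k[n.+1]}) (arrH : hyperplane_arrangement l)
    (* The set of points is nonempty; this only excludes v = n. *)
    (XC_neq0 : exists p : proj_point k n, complement_configuration l B p) :
  let I := complement_ideal l B in
  forall h : nat, (1 < h)%N ->
    (alpha (symbolic_power I h))%:R / h%:R
      >= ((alpha I)%:R + n%:R - 1) / n%:R :> rat.
Proof.
move=> I h h_gt1.
have n_gt0 : (0 < n)%N by lia.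
have [a defl] : exists a, forall j, l j = linform (a j).
  apply: (@fin_all_exists _ (fun=> 'cV[k]_n.+1) (fun j b => l j = linform b)).
  by move=> j; case: arrH => /(_ j)[/homog1_linform].
have {}defl : l = fun j => linform (a j) by apply: functional_extensionality.
subst l.
have leI := alpha_complement_ideal_le arrH B (introT andP (conj n_gt0 le_nv)).
have [[F [FI FP nzF]] _] := alpha_symbolic_power_complement arrH B n_gt0 h.
rewrite -/I in leI FI FP.
set d := alpha (symbolic_power I h) in FP *; clearbody d.
have le_n2v : (n.+2 <= v)%N.
  have [p [s /complement_blocksP[cs sB] _]] := XC_neq0.
  by apply: (steiner_system_large steinerB _ cs sB); rewrite t_gt0.
have le_hv : (h * v <= n * d)%N.
  rewrite leqNgt; apply: contraNN nzF => lt; apply/eqP.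
  have gpA := arrangement_general_position arrH.
  have FX : vanish_off a setT B h F.
    move=> s _ cs sB x _ xs; apply: exp_point_ideal_vanish xs _.
    by apply: FI; apply: point_ideal_associated => //; apply/complement_blocksP.
  (* [t <= n - 1], so an intersection of more than [n - 2] elements contains a [t]-subset. *)
  have sparse b b' : b \in B -> b' \in B -> (n.-2 < #|b :&: b'|)%N -> b = b'.
    move=> bB b'B le; apply: (steiner_system_card_inter steinerB bB b'B).
    by apply: leq_trans le; lia.
  clear le_nv n_gt0 arrH steinerB XC_neq0 leI FI; clear I.
  (* [0 < t < n] forces [n >= 2]; the vanishing theorem is indexed by [n - 2]. *)
  case: n lt_tn => [|[|n]] lt_tn in a F d FP lt gpA FX le_n2v sparse *.
  - by [].
  - by lia.
  by apply: (vanish_off_sparse_eq0 gpA _ sparse FP FX); rewrite cardsT card_ord.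
have hQ : 0 < h%:R :> rat by rewrite ltr0n; lia.
have nQ : 0 < n%:R :> rat by rewrite ltr0n.
rewrite ler_pdivrMr // mulrAC ler_pdivlMr //.
rewrite -natrD -(natrB _ (leq_trans n_gt0 (leq_addl _ _))) -!natrM ler_nat.
(* From [alpha I + n - 1 <= v] and [h * v <= n * d]. *)
nia.
Qed.
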